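(* Let $A$ be an associative Banach $D$-algebra with unit, $a=(a^i_j)$ an $n\times n$ matrix with entries in $A$, and let $b\in A$ be a ${}_*{}^*$-eigenvalue of the matrix $a$. If $$a^i_j\in A[b],\qquad i=1,\dots,n,\quad j=1,\dots,n,$$ then for every ${}_*{}^*$-eigencolumn $c=(c^1,\dots,c^n)^T$ of $a$ corresponding to $b$, the column of maps $$x(t)=e^{bt}c=(e^{bt}c^1,\dots,e^{bt}c^n)^T,\qquad t\in\mathbb{R},$$ is a solution of the system of differential equations $$\frac{dx^i}{dt}=\sum_{k=1}^na^i_kx^k,\qquad i=1,\dots,n.$$
   Context: $D$ is a complete commutative (normed) ring of characteristic $0$; real scalars act on $A$. $A[b]=\{c\in A: cb=bc\}$. $e^{y}=\sum_{n\ge0}\frac1{n!}y^n$. The ${}_*{}^*$-product of matrices is $(p_*{}^*q)^i_j=\sum_kp^i_kq^k_j$ (upper index = row, lower index = column); $E$ is the unit matrix. $b\in A$ is a ${}_*{}^*$-eigenvalue of $a$ if the matrix $a-bE$ is ${}_*{}^*$-singular (has no inverse for the ${}_*{}^*$-product). A column $c$ is a ${}_*{}^*$-eigencolumn of $a$ corresponding to $b$ if $a_*{}^*c=bc$, i.e. $\sum_ka^i_kc^k=bc^i$ for all $i$. The unknowns $x^i:\mathbb{R}\to A$ are $A$-valued functions of a real variable. *)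

(* Defs.v *)
(* MathComp / MathComp-Analysis *)
From HB Require Import structures.
From mathcomp Require Import all_boot all_order all_algebra.
From mathcomp Require Import all_classical all_reals all_analysis.

Set Implicit Arguments.
Unset Strict Implicit.
Unset Printing Implicit Defensive.

Import Order.TTheory GRing.Theory Num.Theory.
Import numFieldNormedType.Exports.

Local Open Scope classical_set_scope.
Local Open Scope ring_scope.

(* The norm of D is a bare function because the norm of a normedZmodType must
   satisfy `|x *+ n| = `|x| *+ n, which a normed ring need not do. *)
Record complete_normed_ring (R : realType) (D : comPzRingType) (nu : D -> R)
  : Prop := CompleteNormedRing {
  nu_ge0 : forall x, 0 <= nu x;
  nu_eq0 : forall x, nu x = 0 <-> x = 0;
  nuN : forall x, nu (- x) = nu x;
  nuD : forall x y, nu (x + y) <= nu x + nu y;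
  nuM : forall x y, nu (x * y) <= nu x * nu y;
  nu_complete : forall u : nat -> D,
    (forall e : R, 0 < e -> exists N, forall i j,
        (N <= i)%N -> (N <= j)%N -> nu (u i - u j) < e) ->
    exists l, forall e : R, 0 < e -> exists N, forall i,
        (N <= i)%N -> nu (u i - l) < e }.

(* Stated directly: over a ring that is not a domain, [pchar D] =i pred0 only
   says that no prime vanishes in D, so it would allow e.g. 'Z_4. *)
Definition characteristic0 (D : pzRingType) : Prop :=
  forall n : nat, n%:R = 0 :> D -> n = 0%N.

(* NumDomain already joins PzRing with NormedZmodule (normed in itself), so
   HB accepts no further structure joining PzRing and NormedModule.  The product
   is therefore introduced by a mixin over complete normed spaces, and the ring
   operations of MathComp live on the alias ring_of A, convertible to A. *)
HB.mixin Record CompleteNormedModule_isBanachAlgebra (R : realType) A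
    & CompleteNormedModule R A := {
  bone : A;
  bmul : A -> A -> A;
  bmulA : associative bmul;
  bmul1x : left_id bone bmul;
  bmulx1 : right_id bone bmul;
  bmulDl : left_distributive bmul +%R;
  bmulDr : right_distributive bmul +%R;
  bscaleAl : forall (r : R) (x y : A), r *: bmul x y = bmul (r *: x) y;
  bscaleAr : forall (r : R) (x y : A), r *: bmul x y = bmul x (r *: y);
  bnormM : forall x y : A, `|bmul x y| <= `|x| * `|y|
}.

#[short(type="banachAlgType")]
HB.structure Definition BanachAlgebra (R : realType) :=
  {A of CompleteNormedModule R A & CompleteNormedModule_isBanachAlgebra R A}.

Definition ring_of (R : realType) (A : banachAlgType R) : Type := A.

HB.instance Definition _ (R : realType) (A : banachAlgType R) :=
  GRing.Lmodule.copy (ring_of A) A.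

HB.instance Definition _ (R : realType) (A : banachAlgType R) :=
  GRing.Zmodule_isPzRing.Build (ring_of A)
    (@bmulA R A) (@bmul1x R A) (@bmulx1 R A) (@bmulDl R A) (@bmulDr R A).

(* A already carries the module structure over the real scalars, so the
   D-module structure is a separate operation.  No compatibility between the two
   needs to be assumed: act d (r *: x) = r *: act d x follows from
   r *: x = (r *: 1) * x and dactAr. *)
Record banach_algebra_over (R : realType) (D : comPzRingType) (nu : D -> R)
    (A : banachAlgType R) (act : D -> ring_of A -> ring_of A) : Prop :=
    BanachAlgebraOver {
  dact1 : forall x, act 1 x = x;
  dactM : forall d e x, act (d * e) x = act d (act e x);
  dactDl : forall d e x, act (d + e) x = act d x + act e x;
  dactDr : forall d x y, act d (x + y) = act d x + act d y;
  dactAl : forall d x y, act d (x * y) = act d x * y;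
  dactAr : forall d x y, act d (x * y) = x * act d y;
  dact_norm : forall d x, `|act d x : A| <= nu d * `|x : A| }.

Definition commutant (A : pzRingType) (b : A) : set A :=
  [set c | c * b = b * c].

(* The product p *m q, with entries \sum_k p i k * q k j, makes sense over a
   noncommutative A; unitmx does not, so invertibility is spelled out. *)
Definition star_singular (A : pzRingType) (n : nat) (p : 'M[A]_n) : Prop :=
  ~ exists q : 'M[A]_n, p *m q = 1%:M /\ q *m p = 1%:M.

Definition star_eigenvalue (A : pzRingType) (n : nat) (a : 'M[A]_n) (b : A)
  : Prop := star_singular (a - b%:M).

Definition star_eigencolumn (A : pzRingType) (n : nat) (a : 'M[A]_n) (b : A)
    (c : 'cV[A]_n) : Prop := a *m c = b *: c.

Definition bexp (R : realType) (A : banachAlgType R) (y : ring_of A) :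
    ring_of A :=
  limn (series (fun k : nat => (k`!%:R : R)^-1 *: (y ^+ k) : A)).

Definition linear_ode_solution (R : realType) (A : banachAlgType R) (n : nat)
    (a : 'M[ring_of A]_n) (x : R -> 'cV[ring_of A]_n) : Prop :=
  forall (i : 'I_n) (t : R),
    is_derive t 1 (fun s : R => x s i 0 : A) (\sum_(k < n) a i k * x t k 0).

(* Main.v *)
(* Since c is an eigencolumn and the entries of a commute with every power of b,
   (d/dt) e^{bt} c^i = e^{bt} b c^i = \sum_k e^{bt} a^i_k c^k
   = \sum_k a^i_k e^{bt} c^k.
   Termwise differentiation of e^{bt} c^i = \sum_k (t^k / k!) b^k c^i is
   justified by a second-order estimate: when |t| + |h| <= r, the remainder
   ((t+h)^k - t^k - h k t^(k-1)) / k! is at most h^2 r^(k-2) / (k-2)! in absolute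
   value, so the remainder of the series is O(h^2). *)
Require Import Defs.
From HB Require Import structures.
From mathcomp Require Import all_boot all_order all_algebra.
From mathcomp Require Import all_classical all_reals all_analysis.
From mathcomp Require Import ring.

Set Implicit Arguments.
Unset Strict Implicit.
Unset Printing Implicit Defensive.

Import Order.TTheory GRing.Theory Num.Theory.
Import numFieldNormedType.Exports.

Local Open Scope classical_set_scope.
Local Open Scope ring_scope.

(** Exponential generating series of [v]. The coefficients are arbitrary vectors so that
    differentiation in [t] becomes the shift of [v]; the case of interest is [v k = b ^+ k * c]. *)
Definition expgen (R : realType) (V : normedModType R) (v : nat -> V) (t : R)
  : V ^nat := fun k => exp_coeff t k *: v k.

(** * Second-order remainders of real powers *)

Lemma exprD_taylor2 (R : realDomainType) (t h r : R) (k : nat) :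
  `|t| + `|h| <= r ->
  `|(t + h) ^+ k.+2 - t ^+ k.+2 - h * (t ^+ k.+1 *+ k.+2)|
    <= h ^+ 2 * (r ^+ k *+ (k.+2 * k.+1)).
Proof.
move=> thr; have r0 : 0 <= r by apply: le_trans thr; rewrite addr_ge0.
elim: k => [|k IHk].
  rewrite !expr0 !expr1 (_ : _ - _ - _ = h ^+ 2); last by ring.
  rewrite ger0_norm ?sqr_ge0// ler_peMr ?sqr_ge0//.
  by rewrite -[1]/(1%:R) ler_nat.
(* The remainders satisfy R_{k+1} = (t + h) R_k + (k+2) h^2 t^(k+1). The bound grows by a factor r
   plus 2(k+2) h^2 r^(k+1), since (k+3)(k+2) = (k+2)(k+1) + 2(k+2); this is twice what is
   required. *)
have -> : (t + h) ^+ k.+3 - t ^+ k.+3 - h * (t ^+ k.+2 *+ k.+3) =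
    (t + h) * ((t + h) ^+ k.+2 - t ^+ k.+2 - h * (t ^+ k.+1 *+ k.+2)) +
    h ^+ 2 * (t ^+ k.+1 *+ k.+2).
  rewrite -[_ *+ k.+3]mulr_natr -[_ *+ k.+2]mulr_natr -[k.+3%:R]natr1 !exprS.
  by move: k.+2%:R => m; ring.
apply: (le_trans (ler_normD _ _)); rewrite !normrM.
have th : `|t + h| <= r by apply: le_trans thr; exact: ler_normD.
have tr : `|t| <= r by apply: le_trans thr; rewrite lerDl.
have -> : h ^+ 2 * (r ^+ k.+1 *+ (k.+3 * k.+2)) =
    r * (h ^+ 2 * (r ^+ k *+ (k.+2 * k.+1))) +
    h ^+ 2 * (r ^+ k.+1 *+ (k.+2 * 2)).
  rewrite -[_ *+ (k.+3 * _)]mulr_natr -[_ *+ (k.+2 * k.+1)]mulr_natr.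
  rewrite -[_ *+ (_ * 2)]mulr_natr !natrM -[k.+3%:R]natr1 -[k.+2%:R]natr1 [r ^+ k.+1]exprS.
  by move: k.+1%:R => m; ring.
apply: lerD; first exact: ler_pM.
rewrite -expr2 real_normK ?num_real// ler_wpM2l ?sqr_ge0//.
rewrite normrMn normrX mulrnA.
apply: (@le_trans _ _ (r ^+ k.+1 *+ k.+2)).
  by rewrite lerMn2r lerXn2r ?orbT// nnegrE.
by rewrite mulr2n lerDl mulrn_wge0// exprn_ge0.
Qed.

(** Division by (k+2)! turns (k+2)(k+1) into 1/k!, so the bounds are again exponential coefficients
    and can be summed. *)
Lemma exp_coeffD_taylor2 (R : realType) (t h r : R) (k : nat) :
  `|t| + `|h| <= r ->
  `|exp_coeff (t + h) k.+2 - exp_coeff t k.+2 - h * exp_coeff t k.+1|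
    <= h ^+ 2 * exp_coeff r k.
Proof.
move=> /(@exprD_taylor2 _ _ _ _ k) thr; rewrite /exp_coeff/=.
have f0 : 0 < k.+2`!%:R :> R by rewrite ltr0n fact_gt0.
rewrite -(ler_pM2r f0) -[X in _ * X <= _](ger0_norm (ltW f0)) -normrM.
have fE : k.+2`!%:R = (k.+2 * k.+1)%:R * k`!%:R :> R.
  by rewrite -natrM !factS mulnA.
have gE : k.+2`!%:R = k.+2%:R * k.+1`!%:R :> R by rewrite -natrM.
have k0 : k`!%:R != 0 :> R by rewrite pnatr_eq0 -lt0n fact_gt0.
have k1 : k.+1`!%:R != 0 :> R by rewrite pnatr_eq0 -lt0n fact_gt0.
rewrite [leLHS](_ : _ = `|(t + h) ^+ k.+2 - t ^+ k.+2 -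
    h * (t ^+ k.+1 *+ k.+2)|); last first.
  congr `|_|; rewrite !mulrBl !divfK ?gt_eqF//; congr (_ - _).
  by rewrite gE; field.
rewrite [leRHS](_ : _ = h ^+ 2 * (r ^+ k *+ (k.+2 * k.+1)))//.
by rewrite fE; field.
Qed.

(** * Convergence and derivative of exponential series in a Banach space *)

Lemma series_exp_coeff_le_expR (R : realType) (x : R) (n : nat) :
  0 <= x -> series (exp_coeff x) n <= expR x.
Proof.
move=> x0; apply: nondecreasing_cvgn_le; last exact: is_cvg_series_exp_coeff.
by apply/nondecreasing_seqP => k; rewrite seriesSr lerDl exp_coeff_ge0.
Qed.

Lemma exp_coeffM (R : realType) (x y : R) (k : nat) :
  exp_coeff x k * y ^+ k = exp_coeff (x * y) k.
Proof. by rewrite /exp_coeff/= exprMn mulrAC. Qed.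

(** Absolute convergence, by comparison with K times the real exponential series at |t| [be]. *)
Lemma is_cvg_expgen (R : realType) (V : completeNormedModType R)
    (v : nat -> V) (K be : R) (t : R) :
  0 <= be -> (forall k, `|v k| <= K * be ^+ k) ->
  cvgn (series (expgen v t)).
Proof.
move=> be0 vK; apply: normed_cvg.
have K0 : 0 <= K by have := vK 0; rewrite expr0 mulr1; apply: le_trans.
apply: (@series_le_cvg _ _ (fun k => K * exp_coeff (`|t| * be) k)).
- by move=> k /=.
- by move=> k; rewrite /= mulr_ge0// exp_coeff_ge0// mulr_ge0.
- move=> k; rewrite /= normrZ -exp_coeffM mulrCA ler_pM//.
  by rewrite /exp_coeff/= normrM normrX normfV normr_nat.
- by apply: is_cvg_seriesZ; exact: is_cvg_series_exp_coeff.
Qed.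

Lemma expgen_taylor2 (R : realType) (V : completeNormedModType R)
    (v : nat -> V) (K be t h r : R) :
  0 <= be -> (forall k, `|v k| <= K * be ^+ k) -> `|t| + `|h| <= r ->
  `|limn (series (expgen v (t + h))) - limn (series (expgen v t))
     - h *: limn (series (expgen (fun k => v k.+1) t))|
    <= h ^+ 2 * (K * be ^+ 2 * expR (r * be)).
Proof.
move=> be0 vK thr.
have K0 : 0 <= K by have := vK 0; rewrite expr0 mulr1; apply: le_trans.
have r0 : 0 <= r by apply: le_trans thr; rewrite addr_ge0.
have vK1 k : `|v k.+1| <= (K * be) * be ^+ k by rewrite -mulrA -exprS.
have cv s := is_cvg_expgen (t := s) be0 vK.
have cv1 := is_cvg_expgen (t := t) be0 vK1.
have shift m (s : V ^nat) : cvgn s -> (fun n => s (n + m)%N) @ \oo --> limn s.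
  by move=> cs; rewrite cvg_shiftn.
(* Taking [n + 2] terms of the series of [v] and [n + 1] of the shifted one pairs index i+2 with
   index i+1, and leaves the lowest terms apart. *)
have lim_rest : (fun n => series (expgen v (t + h)) (n + 2)%N
    - series (expgen v t) (n + 2)%N
    - h *: series (expgen (fun k => v k.+1) t) (n + 1)%N) @ \oo -->
    limn (series (expgen v (t + h))) - limn (series (expgen v t))
    - h *: limn (series (expgen (fun k => v k.+1) t)).
  apply: cvgB; first by apply: cvgB; exact: shift.
  by apply: cvgZ; [exact: cvg_cst|exact: shift].
have /(_ _)cn := cvg_norm lim_rest; rewrite -(cvg_lim _ cn)//.
apply: limr_le; first by apply/cvg_ex; eexists; exact: cn.
apply: nearW => n /=.
rewrite /series/= addn1 addn2 !big_mkord.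
rewrite !(big_ord_recl n.+1) /= !(big_ord_recl n) /=.
rewrite [X in `|X|](_ : _ = \sum_(i < n) (exp_coeff (t + h) i.+2
   - exp_coeff t i.+2 - h * exp_coeff t i.+1) *: v i.+2).
  apply: (le_trans (ler_norm_sum _ _ _)).
  apply: (@le_trans _ _ (\sum_(i < n)
     h ^+ 2 * (K * be ^+ 2 * exp_coeff (r * be) i))).
    apply: ler_sum => i _; rewrite normrZ -exp_coeffM.
    rewrite (_ : h ^+ 2 * _ = h ^+ 2 * exp_coeff r i * (K * be ^+ i.+2)).
      by apply: ler_pM => //; exact: exp_coeffD_taylor2.
    by rewrite -[i.+2]addn2 exprD; ring.
  rewrite -!mulr_sumr !ler_wpM2l ?sqr_ge0 ?mulr_ge0 ?exprn_ge0//.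
  have := @series_exp_coeff_le_expR _ (r * be) n (mulr_ge0 r0 be0).
  by rewrite /series/= big_mkord.
have -> : \sum_(i < n) (exp_coeff (t + h) i.+2 - exp_coeff t i.+2
      - h * exp_coeff t i.+1) *: v i.+2 =
    \sum_(i < n) expgen v (t + h) i.+2 - \sum_(i < n) expgen v t i.+2
    - h *: \sum_(i < n) expgen (fun k => v k.+1) t i.+1.
  rewrite scaler_sumr -!sumrB; apply: eq_bigr => i _.
  by rewrite 2!scalerBl -[(h * _) *: _]scalerA.
(* The lowest terms cancel exactly: v_0 - v_0 = 0 and (t + h) v_1 - t v_1 - h v_1 = 0. *)
rewrite /expgen /exp_coeff/= /bump/= !expr0 !expr1 !divr1 !scale1r.
rewrite opprD addrACA subrr add0r scalerDr !opprD.
rewrite [LHS](AC (2*2*2)%AC ((1*3*5)*(2*4*6))%AC) /= scalerDl.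
by rewrite [t *: _ + _]addrC addrK subrr add0r.
Qed.

Lemma is_derive_expgen (R : realType) (V : completeNormedModType R)
    (v : nat -> V) (K be : R) (t : R) :
  0 <= be -> (forall k, `|v k| <= K * be ^+ k) ->
  is_derive t 1 (fun s : R => limn (series (expgen v s)))
    (limn (series (expgen (fun k => v k.+1) t))).
Proof.
move=> be0 vK; set E := fun s : R => _; set L := limn _.
have K0 : 0 <= K by have := vK 0; rewrite expr0 mulr1; apply: le_trans.
(* The remainder constant for r = |t| + 1, uniform over |h| <= 1. *)
pose M := K * be ^+ 2 * expR ((`|t| + 1) * be).
have M0 : 0 <= M by rewrite !mulr_ge0 ?exprn_ge0 ?expR_ge0.
have quot : h^-1 *: (E (h *: 1 + t) - E t) @[h --> 0^'] --> L.
  apply/cvgrPdist_le => e e0; near=> h.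
  have h0 : h != 0 by near: h; exact: nbhs_dnbhs_neq.
  have h1 : `|h| <= 1.
    by near: h; apply: dnbhs0_le.
  (* [M] may vanish, hence the divisor [M + 1]. *)
  have he : `|h| <= e / (M + 1).
    by near: h; apply: dnbhs0_le; rewrite divr_gt0// ltr_wpDl.
  have := @expgen_taylor2 _ _ _ _ _ t h (`|t| + 1) be0 vK.
  rewrite lerD2l => /(_ h1); rewrite -/(E _) -/(E _) -/L -/M => est.
  rewrite distrC (_ : _ - L = h^-1 *: (E (t + h) - E t - h *: L)); last first.
    rewrite [in RHS]scalerBr scalerA mulVf// scale1r.
    by rewrite -[h *: 1]/(h * 1) mulr1 [h + t]addrC.
  rewrite normrZ normfV ler_pdivrMl ?normr_gt0//; apply: (le_trans est).
  rewrite -real_normK ?num_real// expr2 -mulrA ler_wpM2l//.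
  apply: (@le_trans _ _ (`|h| * (M + 1))); first by rewrite ler_wpM2l// lerDl.
  by rewrite -ler_pdivlMr// ltr_wpDl.
split; first by apply/cvg_ex; exists L.
exact: cvg_lim quot.
Unshelve. all: by end_near. Qed.

(** * Multiplication of series in a Banach algebra *)

Lemma lipschitz_cvg (R : realType) (V W : normedModType R) (f : V -> W) (K : R)
    (u : V ^nat) (l : V) :
  (forall x y, `|f x - f y| <= K * `|x - y|) ->
  u @ \oo --> l -> (f \o u) @ \oo --> f l.
Proof.
move=> fK ul; apply/cvgrPdist_le => e e0; near=> n.
have K1 : 0 < `|K| + 1 by rewrite ltr_wpDl.
apply: (le_trans (fK _ _)).
apply: (@le_trans _ _ ((`|K| + 1) * `|l - u n|)).
  by rewrite ler_wpM2r// (le_trans (ler_norm _))// lerDl.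
rewrite mulrC -ler_pdivlMr//; near: n.
by move/cvgrPdist_le : ul; apply; rewrite divr_gt0.
Unshelve. all: by end_near. Qed.

(** Right multiplication by [c] is additive and Lipschitz with constant |c|, so it passes through
    partial sums and their limit. *)
Lemma lim_series_mulr (R : realType) (A : banachAlgType R) (u : A ^nat)
    (c : ring_of A) :
  cvgn (series u) ->
  (limn (series u) : ring_of A) * c =
  limn (series (fun k => (u k : ring_of A) * c : A)).
Proof.
move=> cu; rewrite [X in _ = limn X](_ : _ =
    (fun x : A => (x : ring_of A) * c : A) \o series u); last first.
  by apply/funext => n; rewrite /series/= mulr_suml.
apply/esym/cvg_lim => //; apply: (@lipschitz_cvg _ _ _ _ `|c : A|) => // x y.
by rewrite mulrC -[_ - _](mulrBl (c : ring_of A)) bnormM.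
Qed.

Lemma lim_series_mull (R : realType) (A : banachAlgType R) (u : A ^nat)
    (c : ring_of A) :
  cvgn (series u) ->
  c * (limn (series u) : ring_of A) =
  limn (series (fun k => c * (u k : ring_of A) : A)).
Proof.
move=> cu; rewrite [X in _ = limn X](_ : _ =
    (fun x : A => c * (x : ring_of A) : A) \o series u); last first.
  by apply/funext => n; rewrite /series/= mulr_sumr.
apply/esym/cvg_lim => //; apply: (@lipschitz_cvg _ _ _ _ `|c : A|) => // x y.
by rewrite -[_ - _](mulrBr (c : ring_of A)) bnormM.
Qed.

Lemma ring_of_scalerAl (R : realType) (A : banachAlgType R) (r : R)
  (x y : ring_of A) : r *: (x * y) = (r *: x) * y.
Proof. exact: bscaleAl. Qed.

Lemma ring_of_scalerAr (R : realType) (A : banachAlgType R) (r : R)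
  (x y : ring_of A) : r *: (x * y) = x * (r *: y).
Proof. exact: bscaleAr. Qed.

Lemma ring_of_exprZn (R : realType) (A : banachAlgType R) (r : R)
  (x : ring_of A) (k : nat) : (r *: x) ^+ k = r ^+ k *: x ^+ k.
Proof.
elim: k => [|k IHk]; first by rewrite !expr0 scale1r.
by rewrite !exprS IHk -ring_of_scalerAl -ring_of_scalerAr scalerA.
Qed.

(** Keeping the factor [c] avoids the norm of the unit, which is not assumed to be 1: at k = 0 both
    sides are |c|. *)
Lemma norm_exprM (R : realType) (A : banachAlgType R) (b c : ring_of A)
  (k : nat) : `|b ^+ k * c : A| <= `|c : A| * `|b : A| ^+ k.
Proof.
elim: k => [|k IHk]; first by rewrite !expr0 mul1r mulr1.
rewrite !exprS -mulrA mulrCA; apply: (le_trans (bnormM _ _)).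
by rewrite ler_wpM2l.
Qed.

(** * The exponential and the differential system *)

Lemma is_cvg_bexp (R : realType) (A : banachAlgType R) (b c : ring_of A)
  (t : R) : cvgn (series (expgen (fun k => b ^+ k * c : A) t)).
Proof. exact: is_cvg_expgen (norm_exprM b c). Qed.

Lemma bexpZM (R : realType) (A : banachAlgType R) (b c : ring_of A) (t : R) :
  bexp (t *: b) * c = limn (series (expgen (fun k => b ^+ k * c : A) t)).
Proof.
have termE : (fun k => (k`!%:R : R)^-1 *: ((t *: b) ^+ k) : A) =
    expgen (fun k => b ^+ k : A) t.
  by apply/funext => k; rewrite ring_of_exprZn scalerA mulrC.
rewrite /bexp termE lim_series_mulr; last first.
  (* The exponential series itself converges as the case [c = 1]. *)
  rewrite (_ : (fun k => b ^+ k : A) = fun k => b ^+ k * 1 : A).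
    exact: is_cvg_bexp.
  by apply/funext => k; rewrite mulr1.
apply: (congr1 (fun u : A ^nat => limn (series u))); apply/funext => k.
by rewrite /expgen -ring_of_scalerAl.
Qed.

(** An element commuting with [b] commutes with each power of [b], hence moves past the exponential
    term by term. *)
Lemma bexp_commM (R : realType) (A : banachAlgType R) (a b c : ring_of A)
  (t : R) : commutant b a -> a * (bexp (t *: b) * c) = bexp (t *: b) * (a * c).
Proof.
move=> ab; rewrite !bexpZM lim_series_mull; last exact: is_cvg_bexp.
apply: (congr1 (fun u : A ^nat => limn (series u))); apply/funext => k.
rewrite /expgen -ring_of_scalerAr; congr (_ *: _).
by rewrite !mulrA (commrX k ab).
Qed.

Lemma is_derive_bexpM (R : realType) (A : banachAlgType R) (b c : ring_of A)
    (t : R) :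
  is_derive t 1 (fun s : R => bexp (s *: b) * c : A)
    (bexp (t *: b) * (b * c) : A).
Proof.
rewrite (_ : (fun s : R => _) =
    fun s => limn (series (expgen (fun k => b ^+ k * c : A) s))); last first.
  by apply/funext => s; rewrite bexpZM.
rewrite bexpZM.
(* Replacing [c] by [b * c] is the shift of the coefficients, that is, the derivative. *)
rewrite (_ : (fun k => b ^+ k * (b * c) : A) = fun k => b ^+ k.+1 * c : A).
  exact: is_derive_expgen (norm_exprM b c).
by apply/funext => k; rewrite exprSr mulrA.
Qed.

Theorem theorem9p3p1 (R : realType)
    (D : comPzRingType) (nu : D -> R)
    (D_complete : complete_normed_ring nu) (D_char0 : characteristic0 D)
    (A : banachAlgType R) (act : D -> ring_of A -> ring_of A)
    (A_banach : banach_algebra_over nu act)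
    (n : nat) (a : 'M[ring_of A]_n) (b : ring_of A)
    (b_eigen : star_eigenvalue a b)
    (a_comm : forall i j : 'I_n, commutant b (a i j)) :
  forall c : 'cV[ring_of A]_n, star_eigencolumn a b c ->
    linear_ode_solution a (fun t : R => \col_(i < n) (bexp (t *: b) * c i 0)).
Proof.
move=> c eig i t.
rewrite (_ : (fun s : R => _) = fun s => bexp (s *: b) * c i 0 : A); last first.
  by apply/funext => s; rewrite mxE.
(* Row [i] of the eigencolumn equation, used from right to left to expand [b * c i 0]. *)
have /matrixP/(_ i 0) := eig; rewrite !mxE => eigi.
rewrite (_ : \sum_(k < n) _ = bexp (t *: b) * (b * c i 0)).
  exact: is_derive_bexpM.
rewrite -eigi mulr_sumr; apply: eq_bigr => k _.
by rewrite mxE bexp_commM.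
Qed.
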